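(* Fix an integer $k\geq 1$ and let $\mathbb{F}=\mathbb{C}(x_0,\ldots,x_{2k},a)$. Let $\varphi$ be the map $(x_0,\ldots,x_{2k})\mapsto\big(x_1,\ldots,x_{2k},(x_1x_{2k}+a(x_k+x_{k+1}))/x_0\big)$, with pullback $\varphi^*G(x_0,\ldots,x_{2k},a)=G(x_1,\ldots,x_{2k},x_{2k+1},a)$ where $x_{2k+1}=(x_1x_{2k}+a(x_k+x_{k+1}))/x_0$. Let $K=P^{(0)}+aP^{(1)}+a^2P^{(2)}\in\mathbb{F}$ with $$P^{(0)}=1+\frac{x_0}{x_{2k}}+\frac{x_{2k}}{x_0},$$ $$P^{(1)}=\Big(1+\frac{x_{2k}}{x_0}\Big)\sum_{j=1}^k\frac{x_{j-1}+x_j}{x_{j+k-1}x_{j+k}}+\Big(1+\frac{x_0}{x_{2k}}\Big)\sum_{j=1}^k\frac{x_{j+k-1}+x_{j+k}}{x_{j-1}x_j},$$ $$P^{(2)}=\frac{1}{x_kx_{2k}}+\sum_{j=0}^{k-1}\frac{1}{x_j}\Big(\frac{1}{x_{j+k}}+\frac{1}{x_{j+k+1}}\Big)+\sum_{\ell=1}^{k-1}\sum_{m=1}^{\ell}\frac{(x_\ell+x_{\ell+1})(x_{k+m-1}+x_{k+m})}{x_{k+\ell}x_{k+\ell+1}x_{m-1}x_m}.$$ Then $\varphi^*K=K$, i.e. $K$ is a first integral (conserved quantity) of $\varphi$. *)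

(* Defs.v *)
From HB Require Import structures.
From mathcomp Require Import all_boot all_order all_algebra.
From mathcomp Require Import generic_quotient fraction.
From mathcomp Require Import reals.
From mathcomp Require Import complex.
From mathcomp Require Import mpoly.

Set Implicit Arguments.
Unset Strict Implicit.
Unset Printing Implicit Defensive.

Import GRing.Theory.
Local Open Scope ring_scope.
Local Open Scope complex_scope.

Section Map.
Variables (R : realType) (k : nat).
(* The indeterminates of index 0, ..., 2k are x_0, ..., x_2k and the last one,
   of index 2k+1, is a. *)
Local Notation A := {mpoly R[i][(2 * k).+2]}.
Local Notation F := {fraction A}.

(* Only meaningful for i <= 2k. *)
Definition xvar (i : nat) : F := FracField.tofrac ('X_(inord i) : A).

Definition avar : F := FracField.tofrac ('X_ord_max : A).

Definition x_next : F := (xvar 1 * xvar (2 * k) + avar * (xvar k + xvar k.+1)) / xvar 0.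

(* The images under phi^* of the indeterminates. *)
Definition phi (i : 'I_(2 * k).+2) : F :=
  if (i < 2 * k)%N then xvar i.+1 else if i == 2 * k :> nat then x_next else avar.

Definition subst_phi (p : A) : F :=
  mmap (fun c : R[i] => FracField.tofrac (c%:MP : A)) phi p.

(* G(x_1, ..., x_2k, x_{2k+1}, a), computed on a numerator and a denominator
   of G; since phi is birational, subst_phi is injective, so the denominator
   does not vanish and the value does not depend on the chosen fraction. *)
Definition pullback (G : F) : F :=
  subst_phi \n_(repr G) / subst_phi \d_(repr G).

Definition P0 : F := 1 + xvar 0 / xvar (2 * k) + xvar (2 * k) / xvar 0.

Definition P1 : F :=
  (1 + xvar (2 * k) / xvar 0) *
    (\sum_(1 <= j < k.+1)
       (xvar (j - 1) + xvar j) / (xvar (j + k - 1) * xvar (j + k))) +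
  (1 + xvar 0 / xvar (2 * k)) *
    (\sum_(1 <= j < k.+1)
       (xvar (j + k - 1) + xvar (j + k)) / (xvar (j - 1) * xvar j)).

Definition P2 : F :=
  1 / (xvar k * xvar (2 * k)) +
  \sum_(0 <= j < k) 1 / xvar j * (1 / xvar (j + k) + 1 / xvar (j + k + 1)) +
  \sum_(1 <= l < k) \sum_(1 <= m < l.+1)
    (xvar l + xvar (l + 1)) * (xvar (k + m - 1) + xvar (k + m)) /
    (xvar (k + l) * xvar (k + l + 1) * xvar (m - 1) * xvar m).

Definition Kint : F := P0 + avar * P1 + avar ^+ 2 * P2.

End Map.

(* Main.v *)
Require Import Defs.
From HB Require Import structures.
From mathcomp Require Import all_boot all_order all_algebra.
From mathcomp Require Import generic_quotient fraction.
From mathcomp Require Import reals.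
From mathcomp Require Import complex.
From mathcomp Require Import mpoly.
From mathcomp Require Import zify ring.

(**
The invariance is a telescoping identity.  Put
[U j = (x_j + x_{j+1}) / (x_{j+k} x_{j+k+1})] and
[V j = (x_{j+k} + x_{j+k+1}) / (x_j x_{j+1})].  The sums occurring in [K] are
[A = \sum_(j < k) U j], [B = \sum_(j < k) V j] and
[D = \sum_(m < l < k) V m * U l], and shifting all indices by one turns them into
[A - U 0 + U k], [B - V 0 + V k] and [D + U k * B - V 0 * (A - U 0 + U k)].
In the difference of the shifted [K] and [K] the coefficients of [A] and [B]
vanish by the recurrence [x_{2k+1} x_0 = x_1 x_{2k} + a (x_k + x_{k+1})], and
the remainder is an identity in six variables.

That the pullback is a field morphism follows from the injectivity of the
substitution on polynomials.  If [p] is in its kernel, clear the powers of [x_0]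
in the image of [p] and apply the substitution of the inverse map: this gives
[p] times a power of [x_{-1}], which is nonzero.
*)

Set Implicit Arguments.
Unset Strict Implicit.
Unset Printing Implicit Defensive.

Import GRing.Theory Num.Theory.
Local Open Scope ring_scope.
Local Open Scope complex_scope.

(** * Invariance of [K] along a solution of the recurrence *)

Section InvariantOfSequence.
Variables (F : fieldType) (k : nat) (a : F).

(** Taking an arbitrary sequence in any field lets an index shift stand for the map. *)
Definition K_seq (x : nat -> F) : F :=
  (1 + x 0%N / x (2 * k)%N + x (2 * k)%N / x 0%N) +
  a * ((1 + x (2 * k)%N / x 0%N) *
         (\sum_(1 <= j < k.+1)
            (x (j - 1)%N + x j) / (x (j + k - 1)%N * x (j + k)%N)) +
       (1 + x 0%N / x (2 * k)%N) *
         (\sum_(1 <= j < k.+1)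
            (x (j + k - 1)%N + x (j + k)%N) / (x (j - 1)%N * x j))) +
  a ^+ 2 * (1 / (x k * x (2 * k)%N) +
    \sum_(0 <= j < k) 1 / x j * (1 / x (j + k)%N + 1 / x (j + k + 1)%N) +
    \sum_(1 <= l < k) \sum_(1 <= m < l.+1)
      (x l + x (l + 1)%N) * (x (k + m - 1)%N + x (k + m)%N) /
      (x (k + l)%N * x (k + l + 1)%N * x (m - 1)%N * x m)).

Lemma eq_K_seq (x y : nat -> F) :
  (forall i, (i <= 2 * k)%N -> x i = y i) -> K_seq x = K_seq y.
Proof.
move=> exy; rewrite /K_seq.
congr (_ + _ * (_ * _ + _ * _) + _ * (_ + _ + _)); rewrite ?exy //; try lia.
- by apply: eq_big_nat => j hj; rewrite !exy //; lia.
- by apply: eq_big_nat => j hj; rewrite !exy //; lia.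
- by apply: eq_big_nat => j hj; rewrite !exy //; lia.
- apply: eq_big_nat => l hl; apply: eq_big_nat => m hm; rewrite !exy //; lia.
Qed.

Definition Useq (x : nat -> F) (j : nat) : F :=
  (x j + x j.+1) / (x (j + k)%N * x (j + k).+1).

Definition Vseq (x : nat -> F) (j : nat) : F :=
  (x (j + k)%N + x (j + k).+1) / (x j * x j.+1).

Definition Wseq (x : nat -> F) (j : nat) : F :=
  1 / x j * (1 / x (j + k)%N + 1 / x (j + k).+1).

Lemma K_seqE (x : nat -> F) :
  K_seq x =
  (1 + x 0%N / x (2 * k)%N + x (2 * k)%N / x 0%N) +
  a * ((1 + x (2 * k)%N / x 0%N) * \sum_(0 <= j < k) Useq x j +
       (1 + x 0%N / x (2 * k)%N) * \sum_(0 <= j < k) Vseq x j) +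
  a ^+ 2 * (1 / (x k * x (2 * k)%N) + \sum_(0 <= j < k) Wseq x j +
    \sum_(0 <= l < k) \sum_(0 <= m < l) Vseq x m * Useq x l).
Proof.
rewrite /K_seq; congr (_ + _ * (_ * _ + _ * _) + _ * (_ + _ + _)).
- rewrite big_add1; apply: eq_big_nat => j hj; rewrite /Useq.
  by congr ((x _ + x _) / (x _ * x _)); lia.
- rewrite big_add1; apply: eq_big_nat => j hj; rewrite /Vseq.
  by congr ((x _ + x _) / (x _ * x _)); lia.
- by apply: eq_big_nat => j hj; rewrite /Wseq addn1.
(* The index [l = 0] contributes an empty inner sum. *)
- have -> (f : nat -> nat -> F) : \sum_(0 <= l < k) \sum_(0 <= m < l) f l m =
      \sum_(1 <= l < k) \sum_(0 <= m < l) f l m.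
    case: k => [|n]; first by rewrite !big_geq.
    by rewrite big_ltn // [X in X + _]big_geq // add0r.
  apply: eq_big_nat => l hl; rewrite big_add1; apply: eq_big_nat => m hm.
  rewrite /Useq /Vseq mulf_div [X in _ = X / _]mulrC.
  rewrite [X in _ = _ / X]mulrC mulrA.
  by congr ((x _ + x _) * (x _ + x _) / (x _ * x _ * x _ * x _)); lia.
Qed.

Lemma sum_shift (f : nat -> F) n :
  \sum_(0 <= j < n) f j.+1 = \sum_(0 <= j < n) f j - f 0%N + f n.
Proof.
have : \sum_(0 <= j < n.+1) f j = f 0%N + \sum_(0 <= j < n) f j.+1.
  by rewrite big_nat_recl.
rewrite big_nat_recr //= => e; rewrite addrAC e; ring.
Qed.

(** The shifted pairs satisfy [1 <= m < l <= n]: compared with [0 <= m < l < n] they gain those with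
    [l = n] and lose those with [m = 0]. *)
Lemma sum_pairs_shift (u v : nat -> F) n :
  \sum_(0 <= l < n) \sum_(0 <= m < l) v m.+1 * u l.+1 =
  \sum_(0 <= l < n) \sum_(0 <= m < l) v m * u l +
  u n * \sum_(0 <= m < n) v m - v 0%N * \sum_(0 <= l < n) u l.+1.
Proof.
elim: n => [|n IHn]; first by rewrite !big_geq // !mulr0 subr0 addr0.
rewrite !big_nat_recr //= IHn -!mulr_suml (sum_shift v) (sum_shift u). ring.
Qed.

Lemma K_seq_shift (x : nat -> F) : (0 < k)%N ->
  (forall i, (i <= (2 * k).+1)%N -> x i != 0) ->
  x (2 * k).+1 * x 0%N = x 1%N * x (2 * k)%N + a * (x k + x k.+1) ->
  K_seq (fun i => x i.+1) = K_seq x.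
Proof.
move=> k_gt0 x_neq0 rec; rewrite !K_seqE.
pose xS i := x i.+1.
have -> : \sum_(0 <= l < k) \sum_(0 <= m < l) Vseq xS m * Useq xS l = _ :=
  sum_pairs_shift (Useq x) (Vseq x) k.
have -> : \sum_(0 <= j < k) Useq xS j = _ := sum_shift (Useq x) k.
have -> : \sum_(0 <= j < k) Vseq xS j = _ := sum_shift (Vseq x) k.
have -> : \sum_(0 <= j < k) Wseq xS j = _ := sum_shift (Wseq x) k.
rewrite {}/xS.
(* From here on the sums are free symbols: their coefficients in the difference vanish by the
   recurrence alone. *)
move: (\sum_(0 <= j < k) Useq x j) (\sum_(0 <= j < k) Vseq x j) => A B.
move: (\sum_(0 <= j < k) Wseq x j) (\sum_(0 <= l < k) _) => W D.
rewrite /Useq /Vseq /Wseq add0n addnn -mul2n.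
have := x_neq0 0%N isT; have := x_neq0 1%N isT.
have := x_neq0 k ltac:(lia); have := x_neq0 k.+1 ltac:(lia).
have := x_neq0 (2 * k)%N ltac:(lia); have := x_neq0 (2 * k).+1 ltac:(lia).
move: rec; move: (x 0%N) (x 1%N) (x k) (x k.+1) (x (2 * k)%N) (x (2 * k).+1).
move=> x0 x1 p q z y rec y0 z0 q0 p0 x10 x00.
have {rec} ey : y = (x1 * z + a * (p + q)) / x0 by rewrite -rec mulfK.
(* [y] occurs in denominators, so eliminating it puts this numerator there. *)
have n0 : x1 * z + a * (p + q) != 0.
  by move: y0; rewrite ey mulf_eq0 negb_or => /andP[].
rewrite ey; field.
by rewrite ?n0 ?x00 ?x10 ?p0 ?q0 ?z0.
Qed.

End InvariantOfSequence.

(** * Composition of substitutions with denominators *)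

Section Substitution.
Variables (n : nat) (C : idomainType).
Local Notation A := {mpoly C[n]}.
Local Notation tofrac := (@FracField.tofrac A).

(** Lets [tofrac] itself be read as a substitution, so that it can be matched with a composite of
    two substitutions. *)
Lemma rmorph_mmap (S : comNzRingType) (f : {rmorphism A -> S}) (p : A) :
  f p = mmap (f \o mpolyC n (R := C)) (fun i => f 'X_i) p.
Proof.
elim/mpolyind: p => [|c m p _ _ ih]; first by rewrite !rmorph0.
rewrite rmorphD [RHS]rmorphD ih /=; congr (_ + _).
rewrite mmapZ mmapX -mul_mpolyC rmorphM /=; congr (_ * _).
by rewrite mpolyXE_id rmorph_prod; apply: eq_bigr => i _; rewrite rmorphXn.
Qed.

Lemma mpoly_ring_ind (P : A -> Prop) :
  (forall c, P c%:MP) -> (forall i, P 'X_i) ->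
  (forall p q, P p -> P q -> P (p + q)) ->
  (forall p q, P p -> P q -> P (p * q)) -> forall p, P p.
Proof.
move=> PC PX PD PM; elim/mpolyind => [|c m p _ _ ih]; first exact: (PC 0).
apply: (PD) => //; rewrite -mul_mpolyC; apply: (PM) => //.
rewrite mpolyXE_id; elim/big_rec: _ => [|i q _ Pq]; first exact: (PC 1).
apply: (PM) => //; elim: (m i) => [|e ihe]; first exact: (PC 1).
by rewrite exprS; apply: (PM).
Qed.

(* A substitution [h] whose values have common denominator [d] composes with
   any specialisation [f] such that [f d != 0], the composite being [g]. *)
Lemma mmap_tofrac_specialize (S : fieldType) (f : {rmorphism A -> S}) (d : A)
    (h : 'I_n -> {fraction A}) (g : 'I_n -> S) :
  f d != 0 ->
  (forall i, exists c, h i * tofrac d = tofrac c /\ g i * f d = f c) ->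
  forall p, mmap (tofrac \o mpolyC n (R := C)) h p = 0 ->
    mmap (f \o mpolyC n (R := C)) g p = 0.
Proof.
move=> fd0 hg p hp0.
have d0 : tofrac d != 0.
  by rewrite tofrac_eq0; apply: contraNneq fd0 => ->; rewrite rmorph0.
(* One exponent [N] and one numerator [r] serve both sides; such pairs are stable under sums and
   products, so constants and variables suffice. *)
have [N [r [hr gr]]] : exists N r,
    mmap (tofrac \o mpolyC n (R := C)) h p * tofrac d ^+ N = tofrac r /\
    mmap (f \o mpolyC n (R := C)) g p * f d ^+ N = f r.
  elim/mpoly_ring_ind: p {hp0} => [c|i|p q [N [r [hr gr]]] [M [s [hs gs]]]
      |p q [N [r [hr gr]]] [M [s [hs gs]]]].
  - by exists 0%N, c%:MP; rewrite !mmapC /= !mulr1.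
  - by have [c] := hg i; exists 1%N, c; rewrite !mmapX !mmap1U.
  - exists (N + M)%N, (r * d ^+ M + s * d ^+ N).
    rewrite !rmorphD !rmorphM !rmorphXn /= -hr -hs -gr -gs !exprD.
    by split; ring.
  - exists (N + M)%N, (r * s).
    rewrite !rmorphM /= -hr -hs -gr -gs !exprD.
    by split; ring.
move: hr; rewrite hp0 mul0r => /esym/eqP; rewrite tofrac_eq0 => /eqP r0.
move/eqP: gr; rewrite r0 rmorph0 mulf_eq0 expf_eq0 (negbTE fd0) andbF orbF.
by move/eqP.
Qed.

End Substitution.

(** * Extension of injective morphisms to the fraction field *)

Section FractionExtension.
Variable A : idomainType.
Local Notation F := {fraction A}.
Local Notation tofrac := (@FracField.tofrac A).

Lemma fraction_numden (G : F) :
  G = tofrac \n_(repr G) / tofrac \d_(repr G).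
Proof.
apply: (canRL (mulfK _)); first by rewrite tofrac_eq0 denom_ratioP.
rewrite -{1}[G]reprK; move: (repr G) => r.
unlock FracField.tofrac; rewrite -[LHS]FracField.pi_mul.
apply/eqmodP; rewrite /= FracField.equivfE /FracField.mulf.
rewrite !numden_Ratio ?oner_neq0 ?mulr1 ?denom_ratioP //.
by apply/eqP; ring.
Qed.

(** Injectivity keeps denominators nonzero, and cross-multiplication makes the value independent of
    the representative. The explicit formula is the one defining [pullback]. *)
Lemma fraction_extension_rmorphism (S : fieldType) (f : {rmorphism A -> S}) :
  (forall p, f p = 0 -> p = 0) ->
  exists h : {rmorphism F -> S},
    (forall G, h G = f \n_(repr G) / f \d_(repr G)) /\
    (forall p, h (tofrac p) = f p).
Proof.
move=> f_inj.
have f_neq0 p : p != 0 -> f p != 0 by apply: contra_neq => /f_inj.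
pose h (G : F) : S := f \n_(repr G) / f \d_(repr G).
have hE n d : d != 0 -> h (tofrac n / tofrac d) = f n / f d.
  move=> d0; rewrite /h; set G := tofrac n / tofrac d.
  have dG0 : \d_(repr G) != 0 by exact: denom_ratioP.
  have /eqP := fraction_numden G.
  rewrite {1}/G (eqr_div (tofrac n)) ?tofrac_eq0 //.
  rewrite -!tofracM tofrac_eq => /eqP e.
  by apply/eqP; rewrite eqr_div ?f_neq0 // -!rmorphM e.
have h_tofrac p : h (tofrac p) = f p.
  by have := hE p 1 (oner_neq0 _); rewrite !rmorph1 !divr1.
have hB : zmod_morphism h.
  move=> x y; rewrite [x]fraction_numden [y]fraction_numden.
  have := denom_ratioP (repr x); have := denom_ratioP (repr y).
  move: (\n_(repr x)) (\d_(repr x)) (\n_(repr y)) (\d_(repr y)).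
  move=> n d m e e0 d0.
  rewrite -mulNr addf_div ?tofrac_eq0 // -tofracN -!tofracM -tofracD.
  rewrite !hE ?mulf_neq0 // -mulNr addf_div ?f_neq0 //.
  by rewrite rmorphD !rmorphM rmorphN.
have hM : monoid_morphism h.
  split=> [|x y]; first by rewrite -(tofrac1 A) h_tofrac rmorph1.
  rewrite [x]fraction_numden [y]fraction_numden.
  have := denom_ratioP (repr x); have := denom_ratioP (repr y).
  move: (\n_(repr x)) (\d_(repr x)) (\n_(repr y)) (\d_(repr y)).
  move=> n d m e e0 d0.
  by rewrite mulf_div -!tofracM !hE ?mulf_neq0 // mulf_div !rmorphM.
pose hZ := GRing.isZmodMorphism.Build _ _ h hB.
pose hR := GRing.isMonoidMorphism.Build _ _ h hM.
pose hh : {rmorphism F -> S} := HB.pack h hZ hR.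
by exists hh.
Qed.

End FractionExtension.

(** * The pullback as a field morphism *)

Section Pullback.
Variables (R : realType) (k : nat).
Local Notation A := {mpoly R[i][(2 * k).+2]}.
Local Notation F := {fraction A}.
Local Notation tofrac := (@FracField.tofrac A).
Local Notation X := (@xvar R k).
Local Notation a := (avar R k).

Lemma xvar_neq0 i : X i != 0.
Proof.
rewrite tofrac_eq0; apply/eqP => /(congr1 (meval (fun _ => 1))).
by rewrite mevalXU rmorph0; apply/eqP; exact: oner_neq0.
Qed.

(* This is [x_{-1}]: the recurrence solved for its lowest-index variable. *)
Definition x_prev : F :=
  (X 0 * X (2 * k).-1 + a * (X k.-1 + X k)) / X (2 * k).

Definition phi_inv (i : 'I_(2 * k).+2) : F :=
  if i == 0%N :> nat then x_prev else if (i <= 2 * k)%N then X i.-1 else a.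

(** At the point with all coordinates 1 the polynomial takes the value 3, whichever indices
    coincide. *)
Lemma tofrac_quadric_neq0 (i j l m : nat) : X i * X j + a * (X l + X m) != 0.
Proof.
rewrite /xvar /avar -tofracD -!tofracM -tofracD tofrac_eq0.
apply/eqP => /(congr1 (meval (fun _ => 1))).
rewrite rmorphD !rmorphM rmorphD /= !mevalXU rmorph0 !mul1r.
by apply/eqP; rewrite (pnatr_eq0 _ 3).
Qed.

Lemma x_prev_neq0 : x_prev != 0.
Proof. by rewrite mulf_neq0 ?invr_eq0 ?xvar_neq0 ?tofrac_quadric_neq0. Qed.

Lemma x_next_neq0 : x_next R k != 0.
Proof. by rewrite mulf_neq0 ?invr_eq0 ?xvar_neq0 ?tofrac_quadric_neq0. Qed.

Lemma subst_phi_inj : (0 < k)%N -> forall p : A, subst_phi p = 0 -> p = 0.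
Proof.
move=> k_gt0 p p0; apply/eqP; rewrite -tofrac_eq0; apply/eqP.
pose f : {rmorphism A -> F} :=
  mmap (tofrac \o mpolyC (2 * k).+2 (R := R[i])) phi_inv.
have fX i : (0 < i <= 2 * k)%N -> f 'X_(inord i) = X i.-1.
  move=> hi; rewrite /f /= mmapX mmap1U /phi_inv inordK; last by lia.
  by case: eqP => [|_]; [lia|case: ifP => //; lia].
have fX0 : f 'X_(inord 0) = x_prev.
  by rewrite /f /= mmapX mmap1U /phi_inv inordK.
have fa : f 'X_ord_max = a.
  by rewrite /f /= mmapX mmap1U /phi_inv /= ltnn.
(* [p] becomes the substitution sending each variable to itself, to be recognised as [phi] followed
   by [f]. *)
rewrite rmorph_mmap.
have eC : tofrac \o mpolyC (2 * k).+2 (R := R[i]) =1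
          f \o mpolyC (2 * k).+2 (R := R[i]).
  by move=> c; rewrite /f /= mmapC.
rewrite /mmap; under eq_bigr do rewrite eC.
apply: (mmap_tofrac_specialize (d := 'X_(inord 0)) (f := f) _ _ p0).
  by rewrite fX0 x_prev_neq0.
move=> i; rewrite /phi.
have [lt_i|ge_i] := ltnP i (2 * k).
  exists ('X_(inord i.+1) * 'X_(inord 0)); rewrite tofracM rmorphM fX0.
  rewrite (fX i.+1) //=.
  by rewrite /xvar inord_val.
have [ei|ni] := eqVneq (i : nat) (2 * k)%N.
  (* Only this image has a denominator, [x_0]. Lowering the indices of its numerator by one gives
     the numerator of [x_prev], that is [x_prev] times [x_2k]. *)
  exists ('X_(inord 1) * 'X_(inord (2 * k)) +
          'X_ord_max * ('X_(inord k) + 'X_(inord k.+1))).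
  rewrite fX0 !(rmorphD, rmorphM) /= fa !fX; [|lia..].
  split; first by rewrite /x_next divfK ?xvar_neq0.
  have -> : i = inord (2 * k) by apply: val_inj; rewrite /= inordK.
  by rewrite [LHS]mulrC divfK ?xvar_neq0.
have -> : i = ord_max by apply: val_inj => /=; have := ltn_ord i; lia.
by exists ('X_ord_max * 'X_(inord 0)); rewrite tofracM rmorphM fa.
Qed.

Lemma pullback_rmorphism : (0 < k)%N ->
  exists h : {rmorphism F -> F},
    (forall G, h G = pullback G) /\
    (forall i, h (tofrac 'X_i) = phi R i).
Proof.
move=> k_gt0.
pose f : {rmorphism A -> F} :=
  mmap (tofrac \o mpolyC (2 * k).+2 (R := R[i])) (@phi R k).
have f_inj : forall p, f p = 0 -> p = 0 := subst_phi_inj k_gt0.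
have [h [hE hX]] := fraction_extension_rmorphism f_inj.
exists h; split=> [G|i]; first by rewrite hE.
by rewrite hX /f /= mmapX mmap1U.
Qed.

Lemma rmorph_K_seq (S : fieldType) (h : {rmorphism F -> S}) (b : F)
    (x : nat -> F) : h (K_seq k b x) = K_seq k (h b) (h \o x).
Proof.
have hD := rmorphD h; have hM := rmorphM h; have hV := fmorphV h.
rewrite /K_seq !(hD, hM, hV, rmorph1, rmorphXn, rmorph_sum) /=.
congr (_ + _ * (_ * _ + _ * _) + _ * (_ + _ + _)).
- by apply: eq_bigr => j _; rewrite !(hD, hM, hV).
- by apply: eq_bigr => j _; rewrite !(hD, hM, hV).
- by apply: eq_bigr => j _; rewrite !(hD, hM, hV, rmorph1).
- apply: eq_bigr => l _; rewrite rmorph_sum.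
  by apply: eq_bigr => j _; rewrite !(hD, hM, hV).
Qed.

End Pullback.

Theorem theorem2p9 (R : realType) (k : nat) (hk : (1 <= k)%N) :
  pullback (Kint R k) = Kint R k.
Proof.
have [h [hE hX]] := pullback_rmorphism R hk.
(* [xvar] at index [2k+1] is [a], so the value [x_{2k+1}] is supplied separately; indices beyond it
   are never read. *)
pose x i := if (i <= 2 * k)%N then xvar R k i else x_next R k.
have KE : Kint R k = K_seq k (avar R k) x.
  by apply: (@eq_K_seq _ _ _ (xvar R k)) => i hi; rewrite /x hi.
rewrite -hE {1}/Kint.
rewrite -[h _]/(h (K_seq k (avar R k) (xvar R k))) rmorph_K_seq KE.
have -> : h (avar R k) = avar R k.
  by rewrite hX /phi /= ltnNge leqnSn /= gtn_eqF.
rewrite -(@K_seq_shift _ _ _ x) //.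
- apply: eq_K_seq => i hi /=; rewrite hX /phi inordK ?ltnS ?(leqW hi) // /x.
  by move: hi; rewrite leq_eqVlt; case: (ltngtP i (2 * k)).
- by move=> i _; rewrite /x; case: ifP; rewrite ?xvar_neq0 ?x_next_neq0.
- rewrite /x ltnn leqnn !ifT; [|lia..].
  by rewrite divfK ?xvar_neq0.
Qed.
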